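(* Let $k,l\ge2$, $n,m\ge1$ be integers, $\alpha>0$, and suppose $f=(f_1,\dots,f_m):[k]^n\to[l]^m$ is $\alpha$-Lipschitz with respect to the $L^1$-norm. Then for any $\delta,\epsilon>0$, there are at least $(1-\delta)m$ coordinates $i\in[m]$ such that $f_i$ is $\epsilon$-close to some $M$-junta $g_i:[k]^n\to[l]$, where $$M\le (l-1)\exp\!\left(\frac{C_3\alpha k}{\delta\epsilon}\right)$$ and $C_3$ is an absolute constant.
   Context: $[k]=\{1,\dots,k\}$. For $x\in[k]^n$ (viewed in $\mathbb{R}^n$), $\|x\|_1=\frac1n\sum_{i=1}^n|x_i|$; for $y\in[l]^m$, $\|y\|_1=\frac1m\sum_{i=1}^m|y_i|$. $f$ is $\alpha$-Lipschitz with respect to the $L^1$-norm if $\|f(x)-f(y)\|_1\le\alpha\|x-y\|_1$ for all $x,y\in[k]^n$. Two functions $h,\tilde h:[k]^n\to[l]$ are $\epsilon$-close if $k^{-n}\sum_{x\in[k]^n}|h(x)-\tilde h(x)|\le\epsilon$. A function $g$ on $[k]^n$ is an $M$-junta if there is $J\subset[n]$ with $|J|=M$ such that $g(x)$ depends only on $(x_j)_{j\in J}$. *)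

(* Defs.v *)
From HB Require Import structures.
From mathcomp Require Import all_boot all_order all_algebra.
From mathcomp Require Import reals sequences exp.

Set Implicit Arguments.
Unset Strict Implicit.
Unset Printing Implicit Defensive.

Import Order.TTheory GRing.Theory Num.Theory.

Local Open Scope ring_scope.

(* The set {1, ..., k}^n.  The ordinal a : 'I_k stands for the element a + 1,
   which is the real number [coord R a]. *)
Notation grid k n := {ffun 'I_n -> 'I_k}.

Definition coord (R : realType) (k : nat) (a : 'I_k) : R := (a.+1)%:R.

Definition grid_vec (R : realType) (k n : nat) (x : grid k n) : 'rV[R]_n :=
  \row_i coord R (x i).

Definition l1norm (R : realType) (n : nat) (v : 'rV[R]_n) : R :=
  n%:R^-1 * \sum_(i < n) `|v 0 i|.

Definition l1_lipschitz (R : realType) (k l n m : nat) (alpha : R)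
    (f : grid k n -> grid l m) : Prop :=
  forall x y : grid k n,
    l1norm (grid_vec R (f x) - grid_vec R (f y))
      <= alpha * l1norm (grid_vec R x - grid_vec R y).

Definition eps_close (R : realType) (k l n : nat) (eps : R)
    (h h' : grid k n -> 'I_l) : Prop :=
  (k%:R ^+ n)^-1 * \sum_(x : grid k n) `|coord R (h x) - coord R (h' x)|
    <= eps.

Definition junta (k l n : nat) (M : nat) (g : grid k n -> 'I_l) : Prop :=
  exists J : {set 'I_n}, #|J| = M /\
    forall x y : grid k n,
      (forall j, j \in J -> x j = y j) -> g x = g y.

(* Main.v *)
Require Import Defs.
From HB Require Import structures.
From mathcomp Require Import all_boot all_order all_algebra.
From mathcomp Require Import reals sequences exp.
From mathcomp Require Import ring lra zify.

(** The grid is encoded in a discrete cube and Friedgut's junta argument is run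
    there.  Writing each coordinate of [k]^n through d binary digits, flipping
    the digit of weight 2^s moves the coordinate by 2^s k / 2^d on average, so
    the Lipschitz condition bounds the influences of all digits, summed over
    all digits and averaged over the m components of f, by 2 alpha k; Markov's
    inequality then selects the good components.  Such a component is the sum
    of its l - 1 threshold functions.  For each of them the Fourier mass
    outside a set of digits with small influences is controlled by the total
    influence on high levels and by the (2,4)-hypercontractive inequality on
    low levels.  Both bounds are linear in the total influence of the
    threshold function, so the errors of all thresholds add up to epsilon with
    one common choice of the level cut-off and of the influence cut-off. *)

Set Implicit Arguments.
Unset Strict Implicit.

Import Order.TTheory GRing.Theory Num.Theory.

Local Open Scope ring_scope.

(** * Fourier analysis on the cube *)

Section CubeFourier.

Variables (R : realFieldType) (V : finType).

Local Notation cube := {ffun V -> bool}.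

Implicit Types (x y : cube) (v : V) (S T U : {set V}) (f g : cube -> R).

Definition flip v x : cube := [ffun u => (u == v) (+) x u].

Lemma flipK v : involutive (flip v).
Proof. by move=> x; apply/ffunP => u; rewrite !ffunE addbA addbb. Qed.

Definition mean f : R := (2 ^+ #|V|)^-1 * \sum_x f x.

Lemma eq_mean f g : f =1 g -> mean f = mean g.
Proof. by move=> fg; congr (_ * _); apply: eq_bigr. Qed.

Lemma meanD f g : mean (fun x => f x + g x) = mean f + mean g.
Proof. by rewrite /mean big_split mulrDr. Qed.

Lemma meanZ (c : R) f : mean (fun x => c * f x) = c * mean f.
Proof. by rewrite /mean -mulr_sumr mulrCA. Qed.

Lemma mean_sum (I : Type) (r : seq I) (P : pred I) (F : I -> cube -> R) :
  mean (fun x => \sum_(i <- r | P i) F i x) = \sum_(i <- r | P i) mean (F i).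
Proof. by rewrite /mean exchange_big /= -mulr_sumr. Qed.

Lemma ler_mean f g : (forall x, f x <= g x) -> mean f <= mean g.
Proof.
move=> fg; apply: ler_wpM2l; first by rewrite invr_ge0 exprn_ge0.
by apply: ler_sum.
Qed.

Lemma mean_ge0 f : (forall x, 0 <= f x) -> 0 <= mean f.
Proof.
by move=> f0; rewrite mulr_ge0 ?invr_ge0 ?exprn_ge0// sumr_ge0.
Qed.

Lemma mean_flip v f : mean (fun x => f (flip v x)) = mean f.
Proof.
by congr (_ * _); rewrite [RHS](reindex_inj (inv_inj (flipK v))).
Qed.

Lemma mean_flip_odd v f : (forall x, f (flip v x) = - f x) -> mean f = 0.
Proof.
move=> odd_f; have := mean_flip v f; rewrite (eq_mean odd_f).
rewrite (eq_mean (g := fun x => -1 * f x)) => [|x]; last by rewrite mulN1r.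
by rewrite meanZ; lra.
Qed.

(** The quadratic form [mean ((a f + b g)^2)] is nonnegative. Taking [(a, b)] to be [(G, -H)] or
    [(-H, F)] gives the discriminant inequality times a positive factor; if [F] and [G] both vanish,
    [(1, 1)] and [(1, -1)] force [H = 0]. *)
Lemma mean_cauchy_schwarz f g :
  mean (fun x => f x * g x) ^+ 2
    <= mean (fun x => f x ^+ 2) * mean (fun x => g x ^+ 2).
Proof.
set F := mean (fun x => f x ^+ 2); set G := mean (fun x => g x ^+ 2).
set H := mean (fun x => f x * g x).
have quad a b : 0 <= a ^+ 2 * F + 2 * a * b * H + b ^+ 2 * G.
  rewrite /F /G /H -!meanZ -!meanD; apply: mean_ge0 => x.
  rewrite [leRHS](_ : _ = (a * f x + b * g x) ^+ 2) ?sqr_ge0//; ring.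
have F0 : 0 <= F by apply: mean_ge0 => x; apply: sqr_ge0.
have G0 : 0 <= G by apply: mean_ge0 => x; apply: sqr_ge0.
have [G_gt0|G_le0] := ltP 0 G.
  rewrite -subr_ge0 -(pmulr_rge0 _ G_gt0).
  by rewrite [leRHS](_ : _ = G ^+ 2 * F + 2 * G * - H * H
      + (- H) ^+ 2 * G) ?quad//; ring.
have [F_gt0|F_le0] := ltP 0 F.
  rewrite -subr_ge0 -(pmulr_rge0 _ F_gt0).
  by rewrite [leRHS](_ : _ = (- H) ^+ 2 * F + 2 * - H * F * H
      + F ^+ 2 * G) ?quad//; ring.
have := quad 1 1; have := quad 1 (-1) => q1 q2.
have -> : H = 0 by nra.
by rewrite expr0n mulr_ge0.
Qed.

Definition chi S x : R := \prod_(v in S) (-1) ^+ x v.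

Lemma chi_flip v S x : chi S (flip v x) = (-1) ^+ (v \in S) * chi S x.
Proof.
rewrite /chi; have [vS|vS] := boolP (v \in S).
  rewrite !(bigD1 v vS)/= ffunE eqxx/= signrN expr1 mulN1r -mulNr; congr (_ * _).
  by apply: eq_bigr => u /andP[_ /negbTE uv]; rewrite ffunE uv.
rewrite mul1r; apply: eq_bigr => u uS; rewrite ffunE.
by case: eqVneq uS vS => // -> ->.
Qed.

Lemma chi_sqr S x : chi S x * chi S x = 1.
Proof.
rewrite /chi -big_split/= big1// => v _.
by rewrite -signr_addb addbb.
Qed.

Lemma chi_setU1 v S x : v \notin S -> chi (v |: S) x = (-1) ^+ x v * chi S x.
Proof. by move=> vS; rewrite /chi big_setU1. Qed.

Lemma mean_chi S T : mean (fun x => chi S x * chi T x) = (S == T)%:R.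
Proof.
case: eqVneq => [<-|ST].
  rewrite (eq_mean (chi_sqr S)) /mean sumr_const card_ffun card_bool natrX.
  by rewrite mulVf ?expf_neq0 ?pnatr_eq0.
have [v vST] : exists v, (v \in S) != (v \in T).
  apply/existsP; rewrite -negb_forall; apply: contra ST => /forallP ST.
  by apply/eqP/setP => v; apply/eqP.
apply: (@mean_flip_odd v) => x; rewrite !chi_flip.
by case: (v \in S) vST; case: (v \in T) => //= _; ring.
Qed.

(** If [x] and [y] differ at [v], the terms of [S] and [v |: S] are opposite, so the sum cancels in
    pairs. *)
Lemma sum_chi x y :
  \sum_S chi S x * chi S y = (2 ^+ #|V|) * (x == y)%:R.
Proof.
case: eqVneq => [<-|xy].
  have cardV : #|{: {set V}}| = (2 ^ #|V|)%N.
    by rewrite -!cardsT -card_powerset; apply: eq_card => S; rewrite !inE subsetT.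
  rewrite (eq_bigr _ (fun S _ => chi_sqr S x)) sumr_const mulr1.
  by rewrite cardV natrX.
have [v /negbTE vxy] : exists v, x v != y v.
  apply/existsP; rewrite -negb_forall; apply: contra xy => /forallP xy.
  by apply/eqP/ffunP => v; apply/eqP.
rewrite (bigID (fun S : {set V} => v \in S))/= (reindex_onto (fun S : {set V} =>
    v |: S) (fun S : {set V} => S :\ v)) /=; last first.
  by move=> S vS; rewrite setD1K.
have -> : \sum_(S | (v \in v |: S) && ((v |: S) :\ v == S)) chi (v |: S) x * chi
    (v |: S) y
   = \sum_(S : {set V} | v \notin S) - (chi S x * chi S y).
  apply: eq_big => [S|S /andP[_ /eqP vS]].
    rewrite setU11/=; apply/eqP/idP => [<-|]; first by rewrite !inE eqxx.
    by move=> vS; rewrite setU1K.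
  have {}vS : v \notin S by rewrite -vS !inE eqxx.
  rewrite !chi_setU1//.
  by case: (x v) vxy; case: (y v) => //= _; ring.
by rewrite sumrN mulr0 addNr.
Qed.

Definition coef f S := mean (fun x => f x * chi S x).

Lemma fourier_inversion f x : f x = \sum_S coef f S * chi S x.
Proof.
rewrite /coef /mean.
under eq_bigr do rewrite -mulrA mulr_suml.
rewrite -mulr_sumr exchange_big /=.
under eq_bigr => y _.
  under eq_bigr do rewrite -mulrA.
  rewrite -mulr_sumr sum_chi mulrCA; over.
rewrite -mulr_sumr mulrA mulVf ?expf_neq0 ?pnatr_eq0// mul1r.
rewrite (bigD1 x)//= eqxx mulr1 big1 ?addr0// => y /negbTE ->.
by rewrite mulr0.
Qed.

Lemma mean_mul_chars f (P : pred {set V}) (c : {set V} -> R) :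
  mean (fun x => f x * \sum_(S | P S) c S * chi S x)
    = \sum_(S | P S) c S * coef f S.
Proof.
rewrite (eq_mean (g := fun x => \sum_(S | P S) c S * (f x * chi S x))).
  by rewrite mean_sum; apply: eq_bigr => S _; rewrite meanZ.
by move=> x; rewrite mulr_sumr; apply: eq_bigr => S _; ring.
Qed.

Lemma coef_chars (P : pred {set V}) (c : {set V} -> R) T :
  coef (fun x => \sum_(S | P S) c S * chi S x) T = (P T)%:R * c T.
Proof.
rewrite /coef (eq_mean (g := fun x => chi T x * \sum_(S | P S) c S * chi S x)).
  rewrite mean_mul_chars /coef; under eq_bigr do rewrite mean_chi.
  have [PT|PT] := boolP (P T).
    rewrite (bigD1 T)//= eqxx big1 ?addr0 ?mulr1 ?mul1r// => S /andP[_ ST].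
    by rewrite eq_sym (negbTE ST) mulr0.
  rewrite big1 ?mul0r// => S PS; case: eqVneq PS PT => [->|_ _ _];
      last by rewrite mulr0.
  by move=> ->.
by move=> x; rewrite mulrC.
Qed.

Lemma parseval (P : pred {set V}) (c : {set V} -> R) :
  mean (fun x => (\sum_(S : {set V} | P S) c S * chi S x) ^+ 2)
      = \sum_(S : {set V} | P S) c S ^+ 2.
Proof.
under eq_mean do rewrite expr2.
rewrite mean_mul_chars; apply: eq_bigr => S PS.
by rewrite coef_chars PS mul1r.
Qed.

Lemma flip_chars v U (P : pred {set V}) (c : {set V} -> R) x :
  v \notin U ->
  \sum_(S : {set V} | (S \subset U) && P S) c S * chi S (flip v x)
    = \sum_(S : {set V} | (S \subset U) && P S) c S * chi S x.
Proof.
move=> vU; apply: eq_bigr => S /andP[/subsetP SU _]; rewrite chi_flip.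
have /negbTE-> : v \notin S by apply: contra vU => /SU.
by rewrite mul1r.
Qed.

(** Bonami's (2,4)-hypercontractive inequality for polynomials of degree at most [D]. The set [U] of
    allowed variables carries the induction while the cube stays fixed. Removing [v] writes the
    polynomial as [a + s b], where [s = (-1)^(x v)] is a sign and [a], [b] are free of [v]; the odd
    powers of [s] average to zero. *)
Lemma bonami (U : {set V}) (D : nat) (c : {set V} -> R) :
  mean (fun x => (\sum_(S : {set V} | (S \subset U) && (#|S| <= D)%N) c S * chi S
      x) ^+ 4)
    <= 9 ^+ D * (\sum_(S : {set V} | (S \subset U) && (#|S| <= D)%N) c S ^+ 2) ^+ 2.
Proof.
elim: {U}#|U| {-2}U (erefl #|U|) D c => [|N IH] U cardU D c.
  have U0 := cards0_eq cardU.
  have eS (S : {set V}) : (S \subset U) && (#|S| <= D)%N = (S == set0).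
    by rewrite U0 subset0; case: eqVneq => // ->; rewrite cards0.
  rewrite !(eq_bigl _ _ eS) big_pred1_eq.
  rewrite (eq_mean (g := fun x => c set0 ^+ 4 * (chi set0 x * chi set0 x))).
    rewrite meanZ mean_chi eqxx mulr1.
    rewrite -exprM -[leLHS]mul1r ler_wpM2r ?exprn_even_ge0//.
    by rewrite exprn_ege1// ler1n.
  by move=> x; rewrite (eq_bigl _ _ eS) big_pred1_eq chi_sqr /chi big_set0 !mulr1.
have [v vU] : exists v, v \in U by apply/set0Pn; rewrite -cards_eq0 cardU.
pose U' := U :\ v.
have vU' : v \notin U' by rewrite !inE eqxx.
have cardU' : #|U'| = N by apply/eq_add_S; rewrite -cardU (cardsD1 v U) vU.
have split (F : {set V} -> R) : \sum_(S : {set V} | (S \subset U) && (#|S| <=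
    D)%N) F S
   = \sum_(S : {set V} | (S \subset U') && (#|S| <= D)%N) F S
     + \sum_(S : {set V} | (S \subset U') && (#|S| < D)%N) F (v |: S).
  rewrite (bigID (fun S : {set V} => v \in S))/= addrC; congr (_ + _).
    by apply: eq_bigl => S; rewrite /U' subsetD1 andbAC.
  rewrite (reindex_onto (fun S : {set V} => v |: S) (fun S : {set V} =>
      S :\ v))/=; last first.
    by move=> S /andP[_ vS]; rewrite setD1K.
  apply: eq_bigl => S; rewrite setU11 andbT.
  have [vS|vS] := boolP (v \in S).
    have /negbTE -> : (v |: S) :\ v != S.
      by apply: contraL vS => /eqP <-; rewrite !inE eqxx.
    by rewrite andbF /U' subsetD1 vS andbF.
  by rewrite setU1K// eqxx andbT subUset sub1set vU cardsU1 vS /U' subsetD1 vS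
      andbT.
set A := \sum_(S : {set V} | (S \subset U') && (#|S| <= D)%N) c S ^+ 2.
set B := \sum_(S : {set V} | (S \subset U') && (#|S| < D)%N) c (v |: S) ^+ 2.
pose a x := \sum_(S : {set V} | (S \subset U') && (#|S| <= D)%N) c S * chi S x.
pose b x := \sum_(S : {set V} | (S \subset U') && (#|S| < D)%N) c (v |: S) * chi
    S x.
have a_flip x : a (flip v x) = a x by exact: flip_chars.
have b_flip x : b (flip v x) = b x.
  exact: (flip_chars (fun S : {set V} => (#|S| < D)%N) (fun S => c (v |: S))).
rewrite split -/A -/B.
have A0 : 0 <= A by rewrite sumr_ge0// => S _; rewrite sqr_ge0.
have B0 : 0 <= B by rewrite sumr_ge0// => S _; rewrite sqr_ge0.
have Ea : mean (fun x => a x ^+ 4) <= 9 ^+ D * A ^+ 2 by exact: IH.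
(* The degree of [b] is one lower, which gains a factor 9; for [D = 0] the sum [b] is empty. *)
have Eb : mean (fun x => b x ^+ 4) * 9 <= 9 ^+ D * B ^+ 2.
  case: (D) @B B0 @b b_flip {Ea} => [|D'] B B0 b b_flip.
    rewrite (eq_mean (g := fun=> 0 * 0)); last first.
      by move=> x; rewrite /b big1 ?expr0n ?mulr0// => S; rewrite ltn0 andbF.
    by rewrite meanZ !mul0r mulr_ge0 ?sqr_ge0.
  by rewrite exprS mulrC -mulrA ler_pM2l//; apply: (IH _ cardU' D' (fun S =>
      c (v |: S))).
have Eab : mean (fun x => a x ^+ 2 * b x ^+ 2) * 3 <= 9 ^+ D * A * B.
  rewrite -ler_sqr ?nnegrE; last 2 first.
  - by rewrite mulr_ge0// mean_ge0// => x; rewrite mulr_ge0 ?sqr_ge0.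
  - by rewrite !mulr_ge0// exprn_ge0.
  have cs := mean_cauchy_schwarz (fun x => a x ^+ 2) (fun x => b x ^+ 2).
  rewrite /= in cs.
  rewrite (eq_mean (f := fun x => (a x ^+ 2) ^+ 2) (g :=
      fun x => a x ^+ 4)) in cs; last by move=> x /=; rewrite -exprM.
  rewrite (eq_mean (f := fun x => (b x ^+ 2) ^+ 2) (g :=
      fun x => b x ^+ 4)) in cs; last by move=> x /=; rewrite -exprM.
  rewrite exprMn; apply: (@le_trans _ _ ((mean (fun x =>
      a x ^+ 4) * (mean (fun x => b x ^+ 4) * 9)))).
    by rewrite mulrA (_ : 3 ^+ 2 = 9 :> R) ?ler_pM2r// -natrX.
  have -> : (9 ^+ D * A * B) ^+ 2 = (9 ^+ D * A ^+ 2) * (9 ^+ D * B ^+ 2) by ring.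
  apply: ler_pM => //; first by apply: mean_ge0 => x; rewrite exprn_even_ge0.
  by rewrite mulr_ge0// mean_ge0// => x; rewrite exprn_even_ge0.
pose s x : R := (-1) ^+ x v.
have s2 x : s x ^+ 2 = 1 by rewrite /s sqrr_sign.
rewrite (eq_mean (g := fun x => (a x ^+ 4 + (6 * (a x ^+ 2 * b x ^+ 2) + b x ^+ 4))
   + s x * (4 * a x ^+ 3 * b x + 4 * a x * b x ^+ 3))); last first.
  move=> x; rewrite split -/(a x).
  have -> : \sum_(S : {set V} | (S \subset U') && (#|S| < D)%N) c (v |: S) * chi
      (v |: S) x = s x * b x.
    rewrite mulr_sumr; apply: eq_bigr => S; rewrite /U' subsetD1 =>
        /andP[/andP[_ vS] _].
    by rewrite chi_setU1// mulrCA.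
  have -> : (a x + s x * b x) ^+ 4 = a x ^+ 4
      + (6 * (s x ^+ 2) * (a x ^+ 2 * b x ^+ 2) + (s x ^+ 2) ^+ 2 * b x ^+ 4)
     + s x * (4 * a x ^+ 3 * b x + 4 * (s x ^+ 2) * a x * b x ^+ 3) by ring.
  by rewrite s2; ring.
have odd0 : mean (fun x => s x * (4 * a x ^+ 3 * b x + 4 * a x * b x ^+ 3)) = 0.
  apply: (@mean_flip_odd v) => x.
  by rewrite a_flip b_flip /s ffunE eqxx signrN; ring.
rewrite 3!meanD meanZ odd0 addr0.
(* The factor 3 gained in [Eab] turns the binomial coefficient 6 into 2, the cross coefficient of
   [(A + B)^2]. *)
apply: (@le_trans _ _ (9 ^+ D * A ^+ 2 + (6 * (3^-1 * (9 ^+ D * A * B))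
    + 9^-1 * (9 ^+ D * B ^+ 2)))).
  by move: Ea Eb Eab; lra.
have := mulr_ge0 (exprn_ge0 D (ler0n R 9)) (sqr_ge0 B).
by rewrite (_ : 9 ^+ D * (A + B) ^+ 2 = 9 ^+ D * A ^+ 2 + 2 * (9 ^+ D * A * B)
    + 9 ^+ D * B ^+ 2); [lra | ring].
Qed.

(** * Influences and Friedgut's junta theorem on the cube *)

Section BooleanFunction.

Variable h : cube -> bool.

Let F x : R := (h x)%:R.

Definition influence v : R := mean (fun x => (h x != h (flip v x))%:R).

Lemma influence_ge0 v : 0 <= influence v.
Proof. by apply: mean_ge0 => x; apply: ler0n. Qed.

Lemma coef_diff v S :
  coef (fun x => F x - F (flip v x)) S = 2 * (v \in S)%:R * coef F S.
Proof.
rewrite /coef (eq_mean (g := fun x => F x * chi S x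
  + -1 * ((-1) ^+ (v \in S) * (F (flip v x) * chi S (flip v x))))); last first.
  by move=> x; rewrite chi_flip; case: (v \in S); rewrite /= ?expr1 ?expr0; ring.
rewrite meanD 2!meanZ (mean_flip v (fun x => F x * chi S x)).
by case: (v \in S); rewrite /= ?expr1 ?expr0; ring.
Qed.

(** The indicator of a change is [(F - F o flip v)^2], and this difference kills the characters
    without [v] and doubles the others; Parseval then gives the factor 4. *)
Lemma influence_fourier v :
  influence v = 4 * \sum_(S : {set V} | v \in S) coef F S ^+ 2.
Proof.
rewrite /influence.
under eq_mean => x.
  have -> : (h x != h (flip v x))%:R = (F x - F (flip v x)) ^+ 2 :> R.
    by rewrite /F; case: (h x); case: (h _); rewrite /= ; ring.
  rewrite (fourier_inversion (fun x => F x - F (flip v x))).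
  under eq_bigr do rewrite coef_diff.
  over.
rewrite (parseval predT) mulr_sumr big_mkcond [RHS]big_mkcond/=.
by apply: eq_bigr => S _; case: (v \in S) => /=; ring.
Qed.

(* With g = F - F o flip v, valued in {-1, 0, 1}, one has g = g * g^2; two
   applications of Cauchy-Schwarz give E[g W]^4 <= E[g^2]^3 E[W^4], which acts as
   a (4/3, 4) Hoelder inequality without fractional powers. *)
Lemma level_inequality v (D : nat) :
  16 * (\sum_(S : {set V} | (v \in S) && (#|S| <= D)%N) coef F S ^+ 2) ^+ 2
    <= 9 ^+ D * influence v ^+ 3.
Proof.
set w := \sum_(S : {set V} | _) _.
pose c S : R := (v \in S)%:R * coef F S.
pose g x := F x - F (flip v x).
pose W x := \sum_(S : {set V} | (S \subset setT) && (#|S| <= D)%N) c S * chi S x.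
have g2 x : g x ^+ 2 = (h x != h (flip v x))%:R.
  by rewrite /g /F; case: (h x); case: (h _); rewrite /= ; ring.
have wE : w = \sum_(S : {set V} | (S \subset setT) && (#|S| <= D)%N) c S ^+ 2.
  rewrite /w big_mkcondl/=; apply: eq_big => [S|S _]; first by rewrite subsetT.
  by rewrite /c; case: (v \in S); rewrite /= ; ring.
have gW : mean (fun x => g x * W x) = 2 * w.
  rewrite mean_mul_chars wE mulr_sumr; apply: eq_bigr => S _.
  by rewrite coef_diff /c; case: (v \in S); rewrite /= ; ring.
have [w0|w0] := eqVneq w 0.
  by rewrite w0 expr0n mulr0 mulr_ge0 ?exprn_ge0// influence_ge0.
have w_gt0 : 0 < w.
  by rewrite lt_def w0 sumr_ge0// => S _; apply: sqr_ge0.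
have W4 : mean (fun x => W x ^+ 4) <= 9 ^+ D * w ^+ 2.
  by rewrite wE; apply: bonami.
have ge0 : 0 <= mean (fun x => g x ^+ 2 * W x ^+ 2).
  by apply: mean_ge0 => x; rewrite mulr_ge0 ?sqr_ge0.
have cs1 : mean (fun x => g x * W x) ^+ 2
    <= influence v * mean (fun x => g x ^+ 2 * W x ^+ 2).
  have := mean_cauchy_schwarz g (fun x => g x ^+ 2 * W x).
  rewrite (eq_mean (f := fun x => _ * (_ * _)) (g := fun x => g x * W x));
      last first.
    by move=> x /=; rewrite mulrA -exprS /g /F; case: (h x); case: (h _);
        rewrite /= ; ring.
  rewrite (eq_mean g2) (eq_mean (f := fun x => (_ * _) ^+ 2) (g :=
      fun x => g x ^+ 2 * W x ^+ 2))//.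
  by move=> x /=; rewrite exprMn g2; case: (_ != _); rewrite /= ; ring.
have cs2 : mean (fun x => g x ^+ 2 * W x ^+ 2) ^+ 2
    <= influence v * mean (fun x => W x ^+ 4).
  have := mean_cauchy_schwarz (fun x => g x ^+ 2) (fun x => W x ^+ 2).
  rewrite /= (eq_mean (f := fun x => (g x ^+ 2) ^+ 2) (g :=
      fun x => (h x != h (flip v x))%:R)); last first.
    by move=> x; rewrite g2; case: (_ != _); rewrite /= ; ring.
  by rewrite (eq_mean (f := fun x => (W x ^+ 2) ^+ 2) (g :=
      fun x => W x ^+ 4))// => x; rewrite -exprM.
rewrite gW in cs1.
have I0 := influence_ge0 v.
have : ((2 * w) ^+ 2) ^+ 2 <= influence v ^+ 2 * (influence v * (9 ^+ D * w ^+ 2)).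
  apply: (@le_trans _ _ ((influence v * mean (fun x => g x ^+ 2 * W x ^+ 2)) ^+ 2)).
    by apply: lerXn2r cs1; rewrite nnegrE ?sqr_ge0// mulr_ge0.
  rewrite exprMn ler_wpM2l ?sqr_ge0//; apply: le_trans cs2 _.
  by rewrite ler_wpM2l.
have -> : ((2 * w) ^+ 2) ^+ 2 = w ^+ 2 * (16 * w ^+ 2) by ring.
have -> : influence v ^+ 2 * (influence v * (9 ^+ D * w ^+ 2))
    = w ^+ 2 * (9 ^+ D * influence v ^+ 3) by ring.
by rewrite ler_pM2l ?exprn_gt0.
Qed.

(** By Parseval the error is the mass of the sets not contained in [J]. A small such set contains
    some [v] outside [J] and is charged to it by [level_inequality]; the cut-off is written
    [tau ^+ 2] so that the square root taken there is rational. A set with more than [D] elements is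
    charged to all its elements, with weight [1 / (D + 1)] each. *)
Lemma friedgut_l2 (J : {set V}) (D : nat) (tau : R) :
  0 <= tau -> (forall v, v \notin J -> influence v <= tau ^+ 2) ->
  mean (fun x => (F x - \sum_(S : {set V} | S \subset J) coef F S * chi S x) ^+ 2)
    <= (3 ^+ D * tau + D.+1%:R^-1) * (\sum_v influence v) / 4.
Proof.
move=> tau0 Jtau.
rewrite (eq_mean (g := fun x => (\sum_(S : {set V} | ~~ (S \subset J)) coef F S *
    chi S x) ^+ 2)); last first.
  move=> x; congr (_ ^+ 2); rewrite [F x]fourier_inversion.
  by rewrite (bigID (fun S : {set V} => S \subset J))/= addrAC subrr add0r.
rewrite parseval mulrDl mulrDl.
pose tail S := \sum_(v | v \in S) D.+1%:R^-1 * coef F S ^+ 2.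
pose low S := \sum_(v | v \notin J) ((v \in S) && (#|S| <= D)%N)%:R * coef F S ^+ 2.
have tail_ge0 S : 0 <= tail S by rewrite sumr_ge0// => v _;
    rewrite mulr_ge0 ?sqr_ge0 ?invr_ge0.
have low_ge0 S : 0 <= low S by rewrite sumr_ge0// => v _; rewrite mulr_ge0 ?sqr_ge0.
apply: (@le_trans _ _ (\sum_S low S + \sum_S tail S)).
  rewrite -big_split/= big_mkcond/=; apply: ler_sum => S _.
  case: ifPn => [/subsetPn[v vS vJ]|_]; last by rewrite addr_ge0.
  have [SD|SD] := leqP #|S| D; [apply: ler_wpDr => // | apply: ler_wpDl => //].
    rewrite /low (bigD1 v)//= vS SD mul1r lerDl sumr_ge0// => u _.
    by rewrite mulr_ge0 ?sqr_ge0.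
  rewrite /tail sumr_const -mulrnAl ler_peMl ?sqr_ge0//.
  by rewrite -[leRHS]mulr_natl ler_pdivlMr// mul1r ler_nat.
apply: lerD.
  rewrite /low exchange_big/= mulr_sumr mulr_suml big_mkcond/=.
  apply: ler_sum => v _; have I0 := influence_ge0 v.
  have rhs_ge0 : 0 <= 3 ^+ D * tau * influence v / 4.
    by rewrite divr_ge0// mulr_ge0// mulr_ge0// exprn_ge0.
  case: ifPn => [vJ|//].
  rewrite (eq_bigr (fun S : {set V} => if (v \in S) && (#|S| <= D)%N then coef F
      S ^+ 2 else 0)); last first.
    by move=> S _; case: ifP => _; rewrite ?mul1r ?mul0r.
  rewrite -big_mkcond/= -ler_sqr ?nnegrE; last 2 first.
  - by rewrite sumr_ge0// => S _; apply: sqr_ge0.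
  - by [].
  have := level_inequality v D.
  have : 9 ^+ D * influence v ^+ 3 <= 16 * (3 ^+ D * tau * influence v / 4) ^+ 2.
    have -> : 16 * (3 ^+ D * tau * influence v / 4) ^+ 2
        = (3 ^+ D) ^+ 2 * (influence v ^+ 2 * tau ^+ 2) by field.
    have -> : (9 : R) = 3 ^+ 2 by ring.
    rewrite exprAC ler_wpM2l ?exprn_ge0//.
    by rewrite exprSr ler_wpM2l ?sqr_ge0// Jtau.
  lra.
rewrite /tail (exchange_big_dep predT)//= mulr_sumr mulr_suml.
apply: ler_sum => v _; rewrite -mulr_sumr influence_fourier.
by move: (D.+1%:R^-1) => q; rewrite (_ : q * (4 * _) / 4
    = q * \sum_(S : {set V} | v \in S) coef F S ^+ 2) //; field.
Qed.

(** The Fourier truncation to [J] is rounded at 1/2. Where the rounding is wrong, truncation and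
    function differ by at least 1/2, so the error indicator is at most 4 times the squared
    difference; this cancels the 1/4 in [friedgut_l2]. *)
Lemma friedgut_cube (J : {set V}) (D : nat) (tau : R) :
  0 <= tau -> (forall v, v \notin J -> influence v <= tau ^+ 2) ->
  exists h' : cube -> bool,
    (forall x y, (forall v, v \in J -> x v = y v) -> h' x = h' y) /\
    mean (fun x => (h x != h' x)%:R)
      <= (3 ^+ D * tau + D.+1%:R^-1) * \sum_v influence v.
Proof.
move=> tau0 Jtau.
pose G x := \sum_(S : {set V} | S \subset J) coef F S * chi S x.
exists (fun x => 2^-1 <= G x); split.
  move=> x y xy; congr (_ <= _); apply: eq_bigr => S /subsetP SJ; congr (_ * _).
  by apply: eq_bigr => v /SJ vJ; rewrite xy.
have := friedgut_l2 D tau0 Jtau; rewrite ler_pdivlMr// mulrC -meanZ.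
apply: le_trans; apply: ler_mean => x; rewrite -/(G x) /F.
have [G2|G2] : 1 <= 2 * G x /\ (2^-1 <= G x) \/ 2 * G x < 1 /\ (2^-1 <= G x)
    = false.
- by case: (lerP 2^-1 (G x)) => ?; [left | right]; split => //; lra.
- by case: G2 => G2 ->; case: (h x) => /=; [rewrite mulr_ge0 ?sqr_ge0 | nra].
by case: G2 => G2 ->; case: (h x) => /=; [nra | rewrite mulr_ge0 ?sqr_ge0].
Qed.

End BooleanFunction.

End CubeFourier.

(** * Encoding the grid in the cube *)

Section BinaryExpansion.

Variable d : nat.

Implicit Types (c : {ffun 'I_d -> bool}).

Definition of_bits c : nat := (\sum_(s < d) c s * 2 ^ s)%N.

Definition to_bits (a : nat) : {ffun 'I_d -> bool} :=
    [ffun s : 'I_d => odd (a %/ 2 ^ s)].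

Lemma to_bitsK a : (a < 2 ^ d)%N -> of_bits (to_bits a) = a.
Proof.
move=> ad; rewrite -[RHS](modn_small ad) /of_bits.
under eq_bigr do rewrite ffunE.
elim: (d) => [|e IH]; first by rewrite big_ord0 modn1.
rewrite big_ord_recr/= IH expnSr.
rewrite [in RHS](divn_eq a (2 ^ e)) -[in RHS](odd_double_half (a %/ 2 ^ e)) -muln2.
set o := odd _; set w := (_./2)%N; set r := (a %% _)%N.
have r_lt : (r < 2 ^ e)%N by rewrite ltn_mod expn_gt0.
have -> : ((o + w * 2) * 2 ^ e + r = w * (2 ^ e * 2) + (r + o * 2 ^ e))%N by lia.
rewrite modnMDl modn_small; first by [].
by case: (o) => /=; lia.
Qed.

Lemma to_bits_bij : bijective (fun a : 'I_(2 ^ d) => to_bits a).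
Proof.
apply: inj_card_bij; last by rewrite card_ffun card_bool !card_ord.
move=> a b ab; apply: val_inj => /=.
by rewrite -(to_bitsK (ltn_ord a)) -(to_bitsK (ltn_ord b)) ab.
Qed.

Lemma of_bits_flip s c :
  c s = false -> of_bits (flip s c) = (of_bits c + 2 ^ s)%N.
Proof.
move=> cs; rewrite /of_bits (bigD1 s)//= [in RHS](bigD1 s)//= ffunE eqxx cs/=.
rewrite mul1n mul0n add0n addnC; congr (_ + _)%N.
by apply: eq_bigr => u /negbTE us; rewrite ffunE us.
Qed.

Lemma sum_of_bits (R : pzRingType) (F : nat -> R) :
  \sum_c F (of_bits c) = \sum_(0 <= a < 2 ^ d) F a.
Proof.
rewrite big_mkord (reindex _ (onW_bij _ to_bits_bij)) /=.
by apply: eq_bigr => a _; rewrite to_bitsK.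
Qed.

End BinaryExpansion.

(** After cancellation only the [h] top terms, each at most [K], and minus the [h] bottom terms
    remain. *)
Lemma sum_shift_diff (R : realFieldType) (phi : nat -> R) (K : R) (N h : nat) :
  (forall a, 0 <= phi a <= K) ->
  \sum_(0 <= a < N) (phi (a + h)%N - phi a) <= h%:R * K.
Proof.
move=> phiK; rewrite sumrB lerBlDr.
have shift : \sum_(0 <= a < N) phi (a + h)%N = \sum_(h <= a < N + h) phi a.
  by rewrite -{2}[h]add0n big_addn addnK.
have : \sum_(0 <= a < h) phi a + \sum_(0 <= a < N) phi (a + h)%N
    = \sum_(0 <= a < N) phi a + \sum_(N <= a < N + h) phi a.
  by rewrite shift -!big_cat_nat//= ?leq_addr ?leq_addl.
have : 0 <= \sum_(0 <= a < h) phi a.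
  by rewrite sumr_ge0// => a _; case/andP: (phiK a).
have : \sum_(N <= a < N + h) phi a <= h%:R * K.
  apply: (@le_trans _ _ (\sum_(N <= a < N + h) K)).
    by apply: ler_sum => a _; case/andP: (phiK a).
  by rewrite sumr_const_nat addKn mulr_natl.
lra.
Qed.

(** Where the digit [s] is 0, flipping it adds [2 ^ s], so monotonicity removes the absolute value;
    the flip maps the other half onto this one. *)
Lemma sum_flip_diff (R : realFieldType) (d : nat) (s : 'I_d) (phi : nat -> R) (K
    : R) :
  (forall a, 0 <= phi a <= K) -> {homo phi : a b / (a <= b)%N >-> a <= b} ->
  \sum_(c : {ffun 'I_d -> bool}) `|phi (of_bits c) - phi (of_bits (flip s c))|
    <= 2 * (2 ^+ s * K).
Proof.
move=> phiK phi_mono; rewrite (bigID (fun c : {ffun 'I_d -> bool} => c s))/=.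
have half : \sum_(c : {ffun 'I_d -> bool} | ~~ c s)
    `|phi (of_bits c) - phi (of_bits (flip s c))| <= 2 ^+ s * K.
  rewrite (eq_bigr (fun c => phi (of_bits c + 2 ^ s)%N - phi (of_bits c)));
      last first.
    move=> c /negbTE cs; rewrite of_bits_flip// distrC ger0_norm//.
    by rewrite subr_ge0 phi_mono// leq_addr.
  rewrite -natrX; apply: le_trans (sum_shift_diff (2 ^ d) (2 ^ s) phiK).
  rewrite -(sum_of_bits d (fun a => phi (a + 2 ^ s)%N - phi a)).
  (* The terms with digit 1 are added back, nonnegative by monotonicity, so that the full sum
     telescopes. *)
  rewrite big_mkcond/=; apply: ler_sum => c _; case: ifP => // _.
  by rewrite subr_ge0 phi_mono// leq_addr.
rewrite (reindex_inj (inv_inj (flipK s)))/=.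
under eq_bigl do rewrite ffunE eqxx addTb.
under eq_bigr do rewrite flipK distrC.
lra.
Qed.

Lemma bernoulli_le (R : realFieldType) (u : R) (n : nat) :
  0 <= u <= 1 -> 1 - n%:R * u <= (1 - u) ^+ n.
Proof.
move=> /andP[u0 u1]; elim: n => [|n IH]; first by rewrite mul0r subr0 expr0.
have : (1 - u) * (1 - n%:R * u) <= (1 - u) * (1 - u) ^+ n.
  by rewrite ler_wpM2l// subr_ge0.
rewrite exprS; apply: le_trans; rewrite -natr1.
have := mulr_ge0 (ler0n R n) (sqr_ge0 u); lra.
Qed.

(** * Transfer of functions between the grid and the cube *)

Section GridCube.

Variables (R : realType) (n d k' q : nat).

Local Notation V := ('I_n * 'I_d)%type.
Local Notation cube := {ffun V -> bool}.

Implicit Types (b : cube) (j : 'I_n).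

Definition slice b j : {ffun 'I_d -> bool} := [ffun s => b (j, s)].

Lemma slice_flip b j s i :
  slice (flip (j, s) b) i = if i == j then flip s (slice b j) else slice b i.
Proof.
apply/ffunP => t; case: (eqVneq i j) => [->|ij]; rewrite !ffunE xpair_eqE.
  by rewrite eqxx.
by rewrite (negbTE ij).
Qed.

(** The slices are independent and uniform: [H] is padded with factors 1 to a product over all
    slices, and the sum of products factorizes. *)
Lemma mean_slice (H : {ffun 'I_d -> bool} -> R) j :
  mean (fun b => H (slice b j)) = mean H.
Proof.
pose curry (b : cube) : {ffun 'I_n -> {ffun 'I_d -> bool}} := [ffun i => slice b i].
pose uncurry (c : {ffun 'I_n -> {ffun 'I_d -> bool}}) : cube :=
    [ffun v => c v.1 v.2].
have uncurry_bij : bijective uncurry.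
  exists curry => [c|b]; apply/ffunP => i; last first.
    by case: i => i s; rewrite !ffunE.
  by apply/ffunP => s; rewrite !ffunE.
rewrite /mean (reindex _ (onW_bij _ uncurry_bij))/=.
have -> : \sum_c H (slice (uncurry c) j) = \sum_(c : {ffun 'I_n -> {ffun 'I_d ->
    bool}}) \prod_i (if i == j then H (c i) else 1).
  apply: eq_bigr => c _; rewrite (bigD1 j)//= eqxx big1 ?mulr1.
    by congr H; apply/ffunP => s; rewrite !ffunE.
  by move=> i /negbTE ->.
rewrite -(bigA_distr_bigA (fun i c => if i == j then H c else 1)) (bigD1 j)//= eqxx.
have -> : \prod_(i < n | i != j) \sum_c (if i == j then H c else 1)
    = (2 ^+ d) ^+ n.-1.
  rewrite (eq_bigr (fun=> 2 ^+ d)) => [|i /negbTE ->]; last first.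
    by rewrite sumr_const card_ffun card_bool card_ord natrX.
  by rewrite prodr_const -[n in n.-1]card_ord -(cardC1 j).
rewrite -exprM mulrCA mulrC; congr (_ * _).
rewrite card_prod !card_ord mulrC.
have -> : (n * d = d + d * n.-1)%N by case: (n) j => [[]//|n0 _];
    rewrite mulSn mulnC.
by rewrite exprD; field; rewrite !expf_neq0 ?pnatr_eq0.
Qed.

(* All k levels have at least q preimages below 2 ^ d; the excess caused by k not
   dividing 2 ^ d is sent to the last one. *)
Definition level (a : nat) : nat := minn (a %/ q) k'.

Definition decode b : grid k'.+1 n := [ffun j =>
    inord (level (of_bits (slice b j)))].

Lemma coord_decode b j :
  Defs.coord R (decode b j) = (level (of_bits (slice b j)))%:R + 1.
Proof. by rewrite /Defs.coord ffunE inordK ?natr1// ltnS geq_minr. Qed.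

Lemma mean_decode_flip j s :
  mean (fun b => `|Defs.coord R (decode b j) - Defs.coord R (decode (flip (j, s)
      b) j)|)
    <= 2 * k'%:R * (2 ^+ s / 2 ^+ d).
Proof.
pose phi a : R := (level a)%:R.
pose H (c : {ffun 'I_d -> bool}) := `|phi (of_bits c) - phi (of_bits (flip s c))|.
rewrite (eq_mean (g := fun b => H (slice b j))); last first.
  by move=> b; rewrite !coord_decode slice_flip eqxx opprD addrACA subrr addr0.
rewrite mean_slice /mean card_ord ler_pdivrMl ?exprn_gt0//.
rewrite (_ : 2 ^+ d * _ = 2 * (2 ^+ s * k'%:R)); last first.
  by field; rewrite expf_neq0 ?pnatr_eq0.
apply: sum_flip_diff => [a|a a' aa'].
  by rewrite /phi ler0n ler_nat geq_minr.
by rewrite ler_nat leq_min geq_minr andbT (leq_trans (geq_minl _ _))// leq_div2r.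
Qed.

Lemma decode_flip_neq b j s i : i != j -> decode (flip (j, s) b) i = decode b i.
Proof. by move=> /negbTE ij; rewrite !ffunE slice_flip ij. Qed.

(** The offset [r] picks one of [q] integers in the block of each coordinate value, so each fixed
    [r] gives a section of [decode]. *)
Definition encode (x : grid k'.+1 n) (r : {ffun 'I_n -> 'I_q}) : cube :=
  [ffun v => to_bits d (x v.1 * q + r v.1)%N v.2].

Hypothesis grid_fits : (k'.+1 * q <= 2 ^ d)%N.

Lemma of_bits_encode x r j : of_bits (slice (encode x r) j) = (x j * q + r j)%N.
Proof.
have -> : slice (encode x r) j = to_bits d (x j * q + r j)%N.
  by apply/ffunP => s; rewrite !ffunE.
apply: to_bitsK; apply: leq_trans grid_fits.
have := ltn_ord (x j); have := ltn_ord (r j); nia.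
Qed.

Lemma encodeK x r : decode (encode x r) = x.
Proof.
apply/ffunP => j; apply: val_inj; rewrite ffunE of_bits_encode /level.
have rq := ltn_ord (r j); rewrite divnMDl; last by apply: leq_trans rq.
rewrite divn_small// addn0 (minn_idPl _)//; last first.
  by rewrite -ltnS.
by rewrite /= inordK.
Qed.

Lemma encode_inj : injective (fun p => encode p.1 p.2).
Proof.
move=> [x r] [y t]/= E; have xy : x = y by rewrite -(encodeK x r) E encodeK.
rewrite {}xy in E *; congr pair; apply/ffunP => j; apply: val_inj => /=.
by have := congr1 (fun b => of_bits (slice b j)) E;
    rewrite !of_bits_encode => /addnI.
Qed.

(* The junta found on the cube is not a function of [decode b]; it is pulled back
   to the grid along a section [encode _ r], chosen by averaging over r. *)
Lemma exists_good_section (G : cube -> R) :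
  (0 < q)%N -> (forall b, 0 <= G b) ->
  exists r, q%:R ^+ n * \sum_x G (encode x r) <= \sum_b G b.
Proof.
move=> q0 G0; pose r0 : {ffun 'I_n -> 'I_q} := [ffun=> Ordinal q0].
have [r _ rmin] := arg_minP (fun r => \sum_x G (encode x r)) (isT : predT r0).
exists r; apply: (@le_trans _ _ (\sum_r' \sum_x G (encode x r'))).
  apply: (@le_trans _ _ (\sum_(r' : {ffun 'I_n -> 'I_q}) \sum_x G (encode x r))).
    by rewrite sumr_const card_ffun !card_ord -natrX mulr_natl.
  by apply: ler_sum => r' _; apply: rmin.
rewrite exchange_big pair_big /=.
rewrite -(big_imset G (A := predT) (h := fun p => encode p.1 p.2))/=; last first.
  by move=> p1 p2 _ _; apply: encode_inj.
by rewrite big_mkcond/=; apply: ler_sum => b _; case: ifP.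
Qed.

Hypothesis q_large : (2 ^ d <= k'.+1 * q + k'.+1)%N.
Hypothesis d_large : (2 * (n * k'.+1) <= 2 ^ d)%N.

(** The encoded points fill at least half of the cube. In each coordinate at most a fraction
    [u = k / 2^d] is missed, and Bernoulli bounds the total loss by [n u], at most 1/2. *)
Lemma grid_density : (2 : R) ^+ (n * d) <= 2 * (k'.+1%:R * q%:R) ^+ n.
Proof.
have [n0|n_gt0] := posnP n; first by rewrite n0 mul0n !expr0; lra.
pose N : R := 2 ^+ d; have N0 : 0 < N by rewrite exprn_gt0.
have fit : k'.+1%:R * q%:R <= N by rewrite /N -natrM -natrX ler_nat.
have ql : N <= k'.+1%:R * q%:R + k'.+1%:R.
  by rewrite /N -natrM -natrX -natrD ler_nat.
have dl : 2 * (n%:R * k'.+1%:R) <= N by rewrite /N -!natrM -natrX ler_nat.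
have k0 : 0 <= k'.+1%:R :> R := ler0n _ _.
have n1 : 1 <= n%:R :> R by rewrite ler1n.
rewrite mulnC exprM -/N.
pose u := k'.+1%:R / N.
have uN : u * N = k'.+1%:R by rewrite /u divfK// gt_eqF.
have u01 : 0 <= u <= 1.
  by apply/andP; split; [rewrite divr_ge0// ltW | rewrite /u ler_pdivrMr// mul1r;
      nra].
have nu : 2 * (n%:R * u) <= 1.
  by rewrite -(ler_pM2r N0) mul1r (_ : _ * N = 2 * (n%:R * (u * N))) ;
      [rewrite uN | ring].
apply: (@le_trans _ _ (2 * ((1 - u) * N) ^+ n)).
  have := bernoulli_le n u01; rewrite exprMn.
  by have := exprn_gt0 n N0; nra.
rewrite ler_pM2l//; apply: lerXn2r; rewrite ?nnegrE ?mulr_ge0//.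
- by rewrite subr_ge0; case/andP: u01.
- exact: ltW.
- by rewrite mulrBl uN mul1r lerBlDr.
Qed.

(** All digits of the coordinates in [J] are kept. Restricted to a section, the cube junta sees [x]
    only through these coordinates; the factor 2 is the price of [grid_density]. *)
Lemma friedgut_grid (h : grid k'.+1 n -> bool) (J : {set 'I_n}) (D : nat) (tau :
    R) :
  (0 < q)%N -> 0 <= tau ->
  (forall v, v.1 \notin J -> influence R (h \o decode) v <= tau ^+ 2) ->
  exists g : grid k'.+1 n -> bool,
    (forall x y : grid k'.+1 n, (forall j, j \in J -> x j = y j) -> g x = g y) /\
    (k'.+1%:R ^+ n)^-1 * \sum_x (h x != g x)%:R
      <= 2 * (3 ^+ D * tau + D.+1%:R^-1) * \sum_v influence R (h \o decode) v.
Proof.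
move=> q0 tau0 Jtau; pose JV := [set v : V | v.1 \in J].
have [|h' [h'J h'close]] := friedgut_cube (h := h \o decode) D tau0 (J := JV).
  by move=> v; rewrite inE; apply: Jtau.
have [//|b|r hr] := exists_good_section (G := fun b =>
    ((h \o decode) b != h' b)%:R).
  by rewrite ler0n.
exists (fun x => h' (encode x r)); split.
  by move=> x y xy; apply: h'J => v; rewrite inE !ffunE => vJ; rewrite xy.
rewrite -mulrA; apply: le_trans (ler_wpM2l (ler0n _ 2) h'close).
(* Writing [h x] as [h (decode (encode x r))] makes the error a sum along the section. *)
under eq_bigr => x _ do rewrite -{1}(encodeK x r).
set X := \sum_x _ in hr *.
rewrite /mean card_prod !card_ord; set Y := \sum_x _.
rewrite -/Y in hr.
have kn : 0 < k'.+1%:R ^+ n :> R by rewrite exprn_gt0.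
have N0 : 0 < (2 : R) ^+ (n * d) by rewrite exprn_gt0.
have dens := grid_density.
rewrite ler_pdivrMl// [2 * (_ * _)]mulrCA [leRHS]mulrCA ler_pdivlMl// [leRHS]mulrCA.
apply: (@le_trans _ _ (2 * (k'.+1%:R * q%:R) ^+ n * X)).
  by apply: ler_wpM2r dens; rewrite sumr_ge0.
by rewrite -mulrA ler_pM2l// exprMn -mulrA ler_pM2l.
Qed.

End GridCube.

(** * Juntas and Lipschitz maps *)

Section Thresholds.

Variables (R : realType) (l' : nat).

Definition threshold (t : 'I_l') (a : 'I_l'.+1) : bool := (t < a)%N.

Lemma sum_threshold (a : 'I_l'.+1) : \sum_t (threshold t a)%:R = a%:R :> R.
Proof.
rewrite -natr_sum; congr (_%:R); rewrite /threshold.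
have al : (a <= l')%N by rewrite -ltnS.
rewrite -[RHS](minn_idPl al); move: (nat_of_ord a) => c; elim: (l') => [|N IH];
    first by rewrite big_ord0 minn0.
by rewrite big_ord_recr/= IH; lia.
Qed.

(** Layer-cake formula: exactly the thresholds lying between [a] and [b] separate them. *)
Lemma sum_threshold_neq (a b : 'I_l'.+1) :
  \sum_t (threshold t a != threshold t b)%:R = `|Defs.coord R a - Defs.coord R b|.
Proof.
wlog ab : a b / (a <= b)%N => [wlog_ab|].
  have [/wlog_ab //|/ltnW/wlog_ab] := leqP a b; rewrite distrC => <-.
  by apply: eq_bigr => t _; rewrite eq_sym.
rewrite /Defs.coord -!natr1 opprD addrACA subrr addr0 distrC ger0_norm ?subr_ge0
    ?ler_nat//.
rewrite -!sum_threshold -sumrB; apply: eq_bigr => t _; rewrite /threshold.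
have [ta|_] := ltnP t a; first by rewrite (leq_trans ta ab)/=; ring.
by case: (t < b)%N; rewrite /= ; ring.
Qed.

End Thresholds.

(** * Junta approximation of integer-valued functions *)

Section JuntaApproximation.

Variables (R : realType) (n d k' q l' : nat).

Local Notation V := ('I_n * 'I_d)%type.
Local Notation decode := (decode (n := n) (d := d) k' q).

Hypotheses (q_gt0 : (0 < q)%N) (grid_fits : (k'.+1 * q <= 2 ^ d)%N).
Hypotheses (q_large : (2 ^ d <= k'.+1 * q + k'.+1)%N).
Hypotheses (d_large : (2 * (n * k'.+1) <= 2 ^ d)%N).

Definition variation (f : grid k'.+1 n -> 'I_l'.+1) (v : V) : R :=
  mean (fun b => `|Defs.coord R (f (decode b)) - Defs.coord R (f (decode (flip v
      b)))|).

Lemma variation_ge0 f v : 0 <= variation f v.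
Proof. exact: mean_ge0. Qed.

Lemma sum_influence_threshold f v :
  \sum_t influence R ((threshold t \o f) \o decode) v = variation f v.
Proof. by rewrite -mean_sum; apply: eq_mean => b; apply: sum_threshold_neq. Qed.

(** One [J] serves all thresholds: it collects the coordinates having a digit of influence above
    [tau ^+ 2] on some threshold. Each of them contributes at least [tau ^+ 2] to the total
    variation, whence the bound on [#|J|]. The threshold errors add up because each is linear in the
    influences, which sum to the variation. *)
Lemma junta_approximation f (D : nat) (tau : R) :
  0 <= tau ->
  exists J : {set 'I_n}, exists g : grid k'.+1 n -> 'I_l'.+1,
    [/\ #|J|%:R * tau ^+ 2 <= \sum_v variation f v,
        forall x y : grid k'.+1 n, (forall j, j \in J -> x j = y j) -> g x = g y &
        eps_close (2 * (3 ^+ D * tau + D.+1%:R^-1) * \sum_v variation f v) f g].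
Proof.
move=> tau0; pose infl t := influence R ((threshold t \o f) \o decode).
pose J := [set j | [exists s, exists t, tau ^+ 2 < infl t (j, s)]].
have inflJ t v : v.1 \notin J -> infl t v <= tau ^+ 2.
  case: v => j s /=; rewrite inE => /existsPn/(_ s)/existsPn/(_ t).
  by rewrite -leNgt.
have /fin_all_exists[g gP] t := friedgut_grid grid_fits q_large d_large D q_gt0
    tau0 (inflJ t).
(* The approximants [g t] may fail to be nested in [t], but a sum of [l'] Booleans is still a legal
   value. *)
have gs x : (\sum_t g t x < l'.+1)%N.
  rewrite ltnS -[leqRHS]card_ord -sum1_card.
  by apply: leq_sum => t _; case: (g t x).
exists J, (fun x => Ordinal (gs x)); split.
- rewrite mulr_natl -sumr_const -(pair_bigA _ (fun j s => variation f (j, s)))/=.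
  rewrite big_mkcond/=; apply: ler_sum => j _.
  have sum0 : 0 <= \sum_s variation f (j, s).
    by rewrite sumr_ge0// => s _; apply: variation_ge0.
  case: ifP => //; rewrite inE => /existsP[s /existsP[t /ltW /le_trans]]; apply.
  rewrite (bigD1 s)//= -sum_influence_threshold (bigD1 t)//= -addrA lerDl.
  rewrite addr_ge0// sumr_ge0// => i _; [exact: influence_ge0 | exact:
      variation_ge0].
- move=> x y xy; apply: val_inj => /=; apply: eq_bigr => t _.
  by rewrite ((gP t).1 x y xy).
rewrite /eps_close.
rewrite -(eq_bigr _ (fun v _ => sum_influence_threshold f v)).
rewrite [X in _ <= _ * X]exchange_big [leRHS]mulr_sumr.
apply: le_trans (ler_sum _ (fun t _ => (gP t).2)).
rewrite -mulr_sumr ler_wpM2l ?invr_ge0 ?exprn_ge0// exchange_big/=.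
apply: ler_sum => x _.
rewrite /Defs.coord -!natr1 opprD addrACA subrr addr0 /= natr_sum -sum_threshold.
rewrite -sumrB; apply: le_trans (ler_norm_sum _ _ _) _.
apply: ler_sum => t _; rewrite /=.
by case: (threshold t _); case: (g t x); rewrite /= ?subrr ?subr0 ?sub0r ?normrN
    ?normr0 ?normr1.
Qed.

End JuntaApproximation.

(** * Total variation of a Lipschitz map *)

Section LipschitzVariation.

Variables (R : realType) (n d k' q l' m : nat).

Lemma l1_diff_norm (k p : nat) (x y : grid k p) :
  l1norm (grid_vec R x - grid_vec R y)
    = p%:R^-1 * \sum_j `|Defs.coord R (x j) - Defs.coord R (y j)|.
Proof. by congr (_ * _); apply: eq_bigr => j _; rewrite !mxE. Qed.

(** Flipping the digit [(j, s)] moves only coordinate [j], so the changes of all components together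
    are at most [alpha m / n] times that move. The average moves form a geometric series in [s], and
    the sum over [j] cancels [1 / n]. *)
Lemma lipschitz_total_variation (alpha : R) (f : grid k'.+1 n -> grid l'.+1 m) :
  (0 < n)%N -> (0 < m)%N -> 0 <= alpha -> l1_lipschitz alpha f ->
  \sum_i \sum_v variation R (d := d) q (fun x =>
      f x i) v <= 2 * alpha * k'%:R * m%:R.
Proof.
move=> n0 m0 alpha0 lip.
have nR : 0 < n%:R :> R by rewrite ltr0n.
have mR : 0 < m%:R :> R by rewrite ltr0n.
pose step (j : 'I_n) (s : 'I_d) : R := alpha * m%:R / n%:R * (2 * k'%:R * (2 ^+ s
    / 2 ^+ d)).
rewrite exchange_big/=.
have var_le v : \sum_i variation R q (fun x => f x i) v <= step v.1 v.2.
  case: v => j s; rewrite /variation -mean_sum.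
  apply: le_trans (ler_wpM2l _ (mean_decode_flip R k' q j s)); last first.
    by rewrite divr_ge0// ?mulr_ge0// ltW.
  rewrite -meanZ; apply: ler_mean => b.
  have := lip (decode k' q b) (decode k' q (flip (j, s) b)).
  rewrite !l1_diff_norm mulrA ler_pdivrMl// (bigD1 j)//= [X in _ + X]big1 ?addr0.
    by rewrite !mulrA [m%:R * _]mulrC.
  by move=> i ij; rewrite decode_flip_neq// subrr normr0.
apply: le_trans (ler_sum _ (fun v _ => var_le v)) _.
rewrite -(pair_bigA _ step) /step sumr_const card_ord -[_ *+ n]mulr_natl
    -mulr_sumr -mulr_sumr -mulr_suml.
have geo : \sum_(s < d) 2 ^+ s <= (2 : R) ^+ d.
  elim: (d) => [|e IH]; first by rewrite big_ord0.
  by rewrite big_ord_recr/= exprS; move: IH; lra.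
have dR : 0 < (2 : R) ^+ d by rewrite exprn_gt0.
have : (\sum_(s < d) 2 ^+ s) / (2 : R) ^+ d <= 1 by rewrite ler_pdivrMr ?mul1r.
move: (_ / _) => G G1.
have -> : n%:R * (alpha * m%:R / n%:R * (2 * k'%:R * G))
    = 2 * alpha * k'%:R * m%:R * G.
  by field; rewrite gt_eqF.
by rewrite ler_piMr// !mulr_ge0// ltW.
Qed.

End LipschitzVariation.

(** * Size estimates, choice of parameters and conclusion *)

Lemma junta_widen (k l n M : nat) (J : {set 'I_n}) (g : grid k n -> 'I_l) :
  (#|J| <= M)%N -> (M <= n)%N ->
  (forall x y : grid k n, (forall j, j \in J -> x j = y j) -> g x
      = g y) -> junta M g.
Proof.
(* [junta] asks for exactly [M] indices, so [J] is padded one index at a time; [M <= n] leaves room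
   for it. *)
move=> JM Mn gJ; have [J' [JJ' cardJ']] : exists J' : {set 'I_n}, J \subset J' /\
    #|J'| = M.
  elim: M JM Mn => [|M IH]; first by rewrite leqn0 => /eqP J0; exists J.
  rewrite leq_eqVlt => /orP[/eqP <- _|JM Mn]; first by exists J.
  have [J' [JJ' cardJ']] := IH JM (ltnW Mn).
  have [j jJ'] : exists j, j \notin J'.
    apply/existsP; rewrite -negb_forall; apply: contraL Mn => /forallP full.
    rewrite -leqNgt -cardJ' -[leqLHS]card_ord -cardsT; apply/subset_leq_card.
    by apply/subsetP => j _; apply: full.
  exists (j |: J'); rewrite cardsU1 jJ' cardJ'; split=> //.
  by apply: subset_trans JJ' (subsetUr _ _).
exists J'; split=> // x y xy; apply: gJ => j jJ; apply: xy.
exact: (subsetP JJ').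
Qed.

(** The exponent is split as [9 beta + 16 beta]: [16 beta^3 <= (3 beta)^3 <= exp (9 beta)], and [9^D
    <= 16^D <= exp (4 D) <= exp (16 beta)] since [exp 1 >= 2]. *)
Lemma junta_size_bound (R : realType) (beta : R) (D : nat) :
  0 <= beta -> D%:R <= 4 * beta -> 16 * beta ^+ 3 * 9 ^+ D <= expR (25 * beta).
Proof.
move=> beta0 Dbeta.
have -> : 25 * beta = 3 * (3 * beta) + 16 * beta by ring.
rewrite expRD expRM_natl; apply: ler_pM.
- by rewrite mulr_ge0 ?exprn_ge0.
- by rewrite exprn_ge0.
- apply: (@le_trans _ _ ((3 * beta) ^+ 3)).
    by rewrite exprMn ler_wpM2r ?exprn_ge0//; lra.
  apply: lerXn2r; rewrite ?nnegrE ?mulr_ge0 ?expR_ge0//.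
  by have := expR_ge1Dx (3 * beta); lra.
apply: (@le_trans _ _ (expR (D%:R * 4))); last by rewrite ler_expR; lra.
rewrite expRM_natl; apply: lerXn2r; rewrite ?nnegrE ?expR_ge0//.
have -> : 4 = 4%:R * 1 :> R by rewrite mulr1.
rewrite expRM_natl; have := expR_ge1Dx (1 : R); move: (expR 1) => e e2.
apply: (@le_trans _ _ (2 ^+ 4)); first by lra.
by apply: lerXn2r; rewrite ?nnegrE; lra.
Qed.

Lemma markov_count (R : realFieldType) (I : finType) (a : I -> R) (B delta : R) :
  0 < delta -> 0 < B -> (forall i, 0 <= a i) -> \sum_i a i <= B * #|I|%:R ->
  (1 - delta) * #|I|%:R <= #|[set i | a i <= B / delta]|%:R.
Proof.
move=> delta0 B0 a0 sum_a; set S := [set i | _].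
have : #|~: S|%:R * (B / delta) <= \sum_i a i.
  rewrite mulr_natl -sumr_const big_mkcond/=; apply: ler_sum => i _.
  by rewrite !inE; case: (leP (a i)) => [_|/ltW].
move=> /le_trans/(_ sum_a); rewrite mulrCA ler_pM2l// ler_pdivrMr//.
have := congr1 (fun N : nat => N%:R : R) (cardsC S); rewrite natrD; lra.
Qed.

Theorem theorem6 (R : realType) :
  exists C3 : R, 0 < C3 /\
  forall (k l n m : nat) (alpha : R) (f : grid k n -> grid l m),
    (2 <= k)%N -> (2 <= l)%N -> (1 <= n)%N -> (1 <= m)%N ->
    0 < alpha ->
    l1_lipschitz alpha f ->
  forall delta eps : R, 0 < delta -> 0 < eps ->
  exists M : nat,
    M%:R <= (l%:R - 1) * expR (C3 * alpha * k%:R / (delta * eps)) /\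
    exists S : {set 'I_m},
      (1 - delta) * m%:R <= #|S|%:R /\
      forall i : 'I_m, i \in S ->
        exists g : grid k n -> 'I_l,
          junta M g /\ eps_close eps (fun x => f x i) g.
Proof.
(* 50 is the 25 of [junta_size_bound] times the 2 in [B]. From here on [k] and [l] denote the
   predecessors of the original sizes. *)
exists 50; split=> // -[//|k] [//|l] n m alpha f _ l2 n1 m1 alpha0 lip delta eps
    delta0 eps0.
pose B := 2 * alpha * k.+1%:R.
have B0 : 0 < B by rewrite !mulr_gt0.
pose A := B / delta; have A0 : 0 < A by rewrite divr_gt0.
pose beta := A / eps; have beta0 : 0 < beta by rewrite divr_gt0.
(* Any [d] with [2 ^ d] at least [2 n k] (original [k]) would do, since the final bound is free of
   [d]. *)
pose d := (2 * (n * k.+1))%N; pose q := (2 ^ d %/ k.+1)%N.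
have d_large : (2 * (n * k.+1) <= 2 ^ d)%N by rewrite ltnW// ltn_expl.
have grid_fits : (k.+1 * q <= 2 ^ d)%N by rewrite mulnC leq_divM.
have q_large : (2 ^ d <= k.+1 * q + k.+1)%N.
  by rewrite mulnC {1}(divn_eq (2 ^ d) k.+1) leq_add2l ltnW// ltn_mod.
have q_gt0 : (0 < q)%N by rewrite divn_gt0//; nia.
pose bound : R := (l.+1%:R - 1) * expR (25 * beta).
have bound0 : 0 <= bound by rewrite mulr_ge0 ?expR_ge0// subr_ge0 ler1n.
(* A single [M] must fit all good components; the cap at [n] allows padding every junta to exactly
   [M] indices. *)
pose M := minn n (Num.truncn bound).
have leM p : (p <= n)%N -> p%:R <= bound -> (p <= M)%N.
  by move=> pn pb; rewrite leq_min pn truncn_ge_nat.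
pose a i := \sum_v variation R (d := d) q (fun x => f x i) v.
exists M; split.
  apply: (@le_trans _ _ (Num.truncn bound)%:R); first by rewrite ler_nat geq_minr.
  have -> : 50 * alpha * k.+1%:R / (delta * eps) = 25 * beta.
    by rewrite /beta /A /B; field; rewrite !gt_eqF.
  by rewrite truncn_le.
exists [set i | a i <= A]; split.
  have := @markov_count R 'I_m a B delta; rewrite card_ord; apply=> //.
    by move=> i; rewrite sumr_ge0// => v _; apply: variation_ge0.
  apply: le_trans (lipschitz_total_variation d q n1 m1 (ltW alpha0) lip) _.
  by rewrite ler_wpM2r// ler_wpM2l ?ler_nat// mulr_ge0// ltW.
move=> i; rewrite inE => aA.
have Mn : (M <= n)%N by rewrite geq_minl.
(* If [eps] exceeds the diameter [l] of the target, a constant is close enough. Otherwise [eps <= l]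
   turns the factor [eps] in the bound on [#|J|] into the factor [l - 1] (original [l]) of the
   theorem. *)
have [eps_small|eps_large] := leP eps l%:R; last first.
  exists (fun=> ord0); split.
    by apply: (@junta_widen _ _ _ _ set0); rewrite ?cards0.
  rewrite /eps_close ler_pdivrMl ?exprn_gt0//.
  apply: (@le_trans _ _ (\sum_(x : grid k.+1 n) eps)).
    apply: ler_sum => x _; rewrite /Defs.coord -!natr1 opprD addrACA subrr addr0
        subr0.
    by rewrite normr_nat (le_trans _ (ltW eps_large))// ler_nat -ltnS.
  by rewrite sumr_const card_ffun !card_ord -[leLHS]mulr_natl natrX.
(* With these [D] and [tau], the level term [1 / (D + 1)] is at most [1 / (4 beta)] and
   [3 ^ D * tau] equals it, so the error is at most [A / beta = eps]. *)
pose D := Num.truncn (4 * beta).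
have beta4 : 0 <= 4 * beta by rewrite mulr_ge0// ltW.
have /andP[D_le D_gt] := truncn_itv beta4.
pose tau := (4 * 3 ^+ D * beta)^-1.
have D3 : 0 < 3 ^+ D :> R by rewrite exprn_gt0.
have tau0 : 0 < tau by rewrite invr_gt0; apply: mulr_gt0 beta0; apply: mulr_gt0.
have [J [g [cardJ gJ g_close]]] :=
  junta_approximation q_gt0 grid_fits q_large d_large (fun x => f x i) D (ltW tau0).
exists g; split.
  apply: (junta_widen _ Mn gJ); apply: leM; first by rewrite -[leqRHS]card_ord
      max_card.
  have : #|J|%:R * tau ^+ 2 <= A by apply: le_trans cardJ aA.
  rewrite -ler_pdivlMr ?exprn_gt0// => /le_trans; apply.
  have -> : A / tau ^+ 2 = eps * (16 * beta ^+ 3 * 9 ^+ D).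
    have -> : 9 = 3 ^+ 2 :> R by ring.
    rewrite exprAC /tau /beta; field.
    by rewrite ?gt_eqF ?divr_gt0//.
  apply: ler_pM; rewrite ?(ltW eps0)//.
  - by apply: mulr_ge0; [apply: mulr_ge0 => //; apply: exprn_ge0;
      apply: ltW | apply: exprn_ge0].
  - by rewrite -natr1 addrK.
  - by apply: junta_size_bound => //; apply: ltW.
apply: le_trans g_close _.
have -> : 3 ^+ D * tau = (4 * beta)^-1.
  by rewrite /tau; field; rewrite !gt_eqF.
have Dinv : D.+1%:R^-1 <= (4 * beta)^-1.
  by rewrite lef_pV2 ?posrE; [apply: ltW | rewrite ltr0n | apply: mulr_gt0].
apply: (@le_trans _ _ (2 * ((4 * beta)^-1 + (4 * beta)^-1) * A)).
  apply: ler_pM => //.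
  - by rewrite mulr_ge0// addr_ge0 ?invr_ge0.
  - by rewrite sumr_ge0// => v _; apply: variation_ge0.
  - by rewrite ler_pM2l// lerD2l.
rewrite /beta (_ : _ * A = eps)//; field.
by rewrite !gt_eqF.
Qed.
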